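(* Let $\phi=\tilde p/p$ be a rational inner function on $\mathbb{D}^d$. For $\lambda\in\mathbb{T}$ define \[\mathcal{C}_\lambda=\overline{\{\zeta\in\mathbb{T}^d\setminus\mathcal{Z}_p:\phi(\zeta)=\lambda\}},\qquad \mathcal{L}_\lambda=\{\zeta\in\mathbb{T}^d:\tilde p(\zeta)=\lambda p(\zeta)\}.\] Then $\mathcal{C}_\lambda=\mathcal{L}_\lambda$ for all $\lambda\in\mathbb{T}$. (In particular $\mathcal{Z}_p\cap\mathbb{T}^d\subseteq\mathcal{C}_\lambda$ for every $\lambda\in\mathbb{T}$.)
   Context: $\mathbb{D}^d$ is the open unit polydisk and $\mathbb{T}^d$ the unit torus in $\mathbb{C}^d$. A rational inner function (RIF) on $\mathbb{D}^d$ is a ratio of polynomials, holomorphic on $\mathbb{D}^d$, with $\lim_{r\nearrow1}|\phi(r\zeta)|=1$ for a.e. $\zeta\in\mathbb{T}^d$; it can be written $\phi=\tilde p/p$ with $p$ a polynomial without zeros in $\mathbb{D}^d$, $p,\tilde p$ without common factors, $\dim(\mathcal{Z}_p\cap\mathbb{T}^d)\le d-2$, and $\tilde p(z)=z_1^{n_1}\cdots z_d^{n_d}\overline{p(1/\bar z_1,\dots,1/\bar z_d)}$ where $(n_1,\dots,n_d)=\deg\phi$. $\mathcal{Z}_p$ is the zero set of $p$; note $\mathcal{Z}_p\cap\mathbb{T}^d=\mathcal{Z}_{\tilde p}\cap\mathbb{T}^d$. *)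

(* Defs.v *)
From HB Require Import structures.
From mathcomp Require Import all_boot all_order all_algebra.
From mathcomp Require Import reals.
From mathcomp Require Import complex.
From mathcomp Require Import mpoly.
Set Implicit Arguments. Unset Strict Implicit. Unset Printing Implicit Defensive.
Import Order.TTheory GRing.Theory Num.Theory ComplexField.
Local Open Scope ring_scope.

Section RIF.
Variables (R : realType) (d : nat).
Local Notation C := (R[i]).

Definition polydisk (z : 'I_d -> C) : Prop := forall j, `|z j| < 1.
Definition torus (z : 'I_d -> C) : Prop := forall j, `|z j| = 1.

Definition deg_le (p : {mpoly C[d]}) (n : 'X_{1..d}) : Prop :=
  forall m, m \in msupp p -> forall j, (m j <= n j)%N.

(* reflection  p~(z) = z^n * conj(p(1/conj z)),  written on coefficients:
   p = sum c_m z^m  ==>  p~ = sum conj(c_m) z^(n-m) *)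
Definition reflect_poly (n : 'X_{1..d}) (p : {mpoly C[d]}) : {mpoly C[d]} :=
  \sum_(m <- msupp p) (p@_m)^* *: 'X_[n - m].

Definition no_common_factor (p q : {mpoly C[d]}) : Prop :=
  forall f g h : {mpoly C[d]}, p = f * g -> q = f * h -> exists c : C, f = c%:MP.

(* phi = p~/p is a rational inner function on D^d, with deg phi = n *)
Definition RIF_repr (p : {mpoly C[d]}) (n : 'X_{1..d}) : Prop :=
  [/\ forall z, polydisk z -> p.@[z] != 0,
      deg_le p n &
      no_common_factor p (reflect_poly n p)].

Definition closure_Cd (S : ('I_d -> C) -> Prop) (z : 'I_d -> C) : Prop :=
  forall e : R, 0 < e -> exists2 w, S w & forall j, `|w j - z j| < (e%:C)%C.

Definition Clam (p : {mpoly C[d]}) (n : 'X_{1..d}) (lam : C) :=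
  closure_Cd (fun z => [/\ torus z, p.@[z] != 0 & (reflect_poly n p).@[z] / p.@[z] = lam]).

Definition Llam (p : {mpoly C[d]}) (n : 'X_{1..d}) (lam : C) (z : 'I_d -> C) :=
  torus z /\ (reflect_poly n p).@[z] = lam * p.@[z].

End RIF.

(* Main.v *)
Require Import Defs.
From HB Require Import structures.
From mathcomp Require Import all_boot all_order all_algebra.
From mathcomp Require Import zify ring boolp reals complex mpoly.
Set Implicit Arguments. Unset Strict Implicit. Unset Printing Implicit Defensive.
Import Order.TTheory GRing.Theory Num.Theory ComplexField.
Local Open Scope ring_scope.

(** Only points [z] of the torus with [p z = p~ z = 0] are delicate.  Write
    [q = p~ - lam p] and restrict to the slices [t |-> q (t w)] with [w] on the torus.
    Each slice of [p] is a product of factors [t - r] with [|r| >= 1], so comparing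
    the factors with [1 - r^* t] shows that all zeros of [q (t w)] lie on the unit
    circle.  The leading coefficient of the slice has a modulus independent of [w],
    and [q w] is small near [z], so the slice has a zero near [t = 1].  If [p] vanished
    at all these zeros of [q], then [p (t w)] and [p~ (t w)] would have a common root
    in [t] for every [w] in a relatively open subset of the torus.  A Bezout relation
    over the polynomial ring in [w] forces them to have a common factor, which, by
    unique factorization and after substituting [w / s] for [w] and [s] for [t], is a
    common factor of [p] and [p~]. *)

(** * Gauss's lemma: polynomials over a factorial domain *)

Definition divides (A : idomainType) (x a : A) : Prop := exists u, a = u * x.

Definition prime_element (A : idomainType) (x : A) : Prop :=
  [/\ x != 0, x \isn't a GRing.unit &
      forall a b, divides x (a * b) -> divides x a \/ divides x b].

(** The factors are prime rather than irreducible, so the mere existence of such products makes a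
    domain factorial: uniqueness is then automatic. *)
Inductive prime_product (A : idomainType) : A -> Prop :=
| prime_product_unit u : u \is a GRing.unit -> prime_product u
| prime_product_cons x a :
    prime_element x -> prime_product a -> prime_product (x * a).

Definition factorial_domain (A : idomainType) : Prop :=
  forall a : A, a != 0 -> prime_product a.

Definition primitive_poly (A : idomainType) (f : {poly A}) : Prop :=
  forall x, prime_element x -> ~ divides x%:P f.

Lemma prime_product_mul (A : idomainType) (a b : A) :
  prime_product a -> prime_product b -> prime_product (a * b).
Proof.
elim=> [u uu|x {}a px _ IH] pb; last first.
  by rewrite -mulrA; apply: prime_product_cons => //; exact: IH.
elim: pb => [v vu|x {}b px _ IH]; first by apply: prime_product_unit; rewrite unitrM uu.
by rewrite mulrCA; apply: prime_product_cons.
Qed.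

Lemma divides_unit (A : idomainType) (x u : A) :
  divides x u -> u \is a GRing.unit -> x \is a GRing.unit.
Proof. by case=> v ->; rewrite unitrM => /andP[]. Qed.

Lemma divides_polyC (A : idomainType) (x : A) (f : {poly A}) :
  divides x%:P f <-> forall i, divides x f`_i.
Proof.
split=> [[u ->] i|]; first by exists u`_i; rewrite coefMC.
elim/poly_ind: f => [|f c IH] H; first by exists 0; rewrite mul0r.
have [u eu] : divides x%:P f.
  by apply: IH => i; have := H i.+1; rewrite coefD coefMX coefC /= addr0.
have [v ev] : divides x c by have := H 0%N; rewrite coefD coefMX coefC /= add0r.
by exists (u * 'X + v%:P); rewrite eu ev polyCM mulrDl mulrAC.
Qed.

Lemma divides_mulX (A : idomainType) (x : A) (f : {poly A}) :
  divides x%:P (f * 'X) -> divides x%:P f.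
Proof.
by move=> /divides_polyC H; apply/divides_polyC => i; have := H i.+1; rewrite coefMX.
Qed.

Lemma divides_mull (A : idomainType) (x a b : A) : divides x a -> divides x (b * a).
Proof. by case=> u ->; exists (b * u); rewrite mulrA. Qed.

Lemma dividesD (A : idomainType) (x a b : A) :
  divides x a -> divides x b -> divides x (a + b).
Proof. by case=> u -> [v ->]; exists (u + v); rewrite mulrDl. Qed.

Lemma dividesB (A : idomainType) (x a b : A) :
  divides x (a + b) -> divides x b -> divides x a.
Proof. by case=> u eu [v ev]; exists (u - v); rewrite mulrBl -eu -ev addrK. Qed.

(** Constant terms are peeled off: [x] divides [c * e], hence [c] or [e]; subtracting the
    corresponding multiple and cancelling ['X] leaves a product with one factor shorter. *)
Lemma prime_polyC (A : idomainType) (x : A) : prime_element x -> prime_element x%:P.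
Proof.
case=> x0 xu xP; split; rewrite ?polyC_eq0 //.
  by rewrite poly_unitE coefC /= negb_and xu orbT.
elim/poly_ind=> [b _|a c IHa]; first by left; exists 0; rewrite mul0r.
elim/poly_ind=> [_|b e IHb]; first by right; exists 0; rewrite mul0r.
move=> D; have [xc|xe] : divides x c \/ divides x e.
  apply: xP; move/divides_polyC/(_ 0%N): D.
  by rewrite coef0M !coefD !coefMX !coefC /= !add0r.
- have xcP : divides x%:P c%:P by case: xc => u ->; exists u%:P; rewrite polyCM.
  have : divides x%:P (a * (b * 'X + e%:P)).
    apply/divides_mulX; apply: (@dividesB _ _ _ ((b * 'X + e%:P) * c%:P)).
      by move: D; congr divides; rewrite mulrDl mulrAC [c%:P * _]mulrC.
    exact: divides_mull.
  case/IHa; last by right.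
  by move=> xa; left; apply: dividesD => //; rewrite mulrC; apply: divides_mull.
- have xeP : divides x%:P e%:P by case: xe => u ->; exists u%:P; rewrite polyCM.
  have : divides x%:P ((a * 'X + c%:P) * b).
    apply/divides_mulX; apply: (@dividesB _ _ _ ((a * 'X + c%:P) * e%:P)).
      by move: D; congr divides; rewrite mulrDr mulrA.
    exact: divides_mull.
  case/IHb; first by left.
  by move=> xb; right; apply: dividesD => //; rewrite mulrC; apply: divides_mull.
Qed.

Lemma prime_product_polyC (A : idomainType) (a : A) :
  prime_product a -> prime_product a%:P.
Proof.
elim=> [u uu|x {}a px _ IH].
  have u0 : u != 0 by apply: contraTneq uu => ->; rewrite unitr0.
  by apply: prime_product_unit; rewrite poly_unitE size_polyC coefC /= uu u0.
by rewrite polyCM; apply: prime_product_cons => //; exact: prime_polyC.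
Qed.

(** [l] bounds the content of [f]; the induction peels primes off both of them.  The
    leading coefficient is a suitable [l]. *)
Lemma primitive_part (A : idomainType) (l : A) : prime_product l ->
  forall f : {poly A}, (forall c, divides c%:P f -> divides c l) ->
  exists c g, f = c%:P * g /\ primitive_poly g.
Proof.
elim=> [u uu|x a px _ IH] f H.
  exists 1, f; rewrite mul1r; split=> // x [_ /negP xu _] /H xdu.
  by apply: xu; apply: divides_unit xdu uu.
have [x0 _ xP] := px.
have [[g eg]|ndf] := EM (divides x%:P f).
  have [|c [h [eh ph]]] := IH g.
    move=> c [v ev]; have [|w] := H (c * x).
      by exists v; rewrite eg ev polyCM mulrA.
    by rewrite mulrA [RHS]mulrC => /(mulfI x0) ->; exists w.
  by exists (x * c), h; rewrite eg eh polyCM; split=> //; rewrite mulrC mulrA.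
(* Since [x] does not divide [f], it divides no divisor [c] of [f]; so in [x * a = w * c] it divides
   [w], and [c] divides [a]. *)
apply: IH => c cf; have [w ew] := H _ cf.
have [|[v ev]|[v ev]] := xP w c; first by exists a; rewrite -ew mulrC.
  by move: ew; rewrite ev mulrAC mulrC => /(mulIf x0) ->; exists v.
by case: ndf; case: cf => z ->; exists (z * v%:P); rewrite ev polyCM mulrA.
Qed.

(** The primes of [c] are cancelled one by one: each stays prime as a constant polynomial and, not
    dividing the primitive [f], must divide [u]. *)
Lemma primitive_cancel (A : idomainType) (c : A) : prime_product c ->
  forall f g u : {poly A}, primitive_poly f -> c%:P * g = u * f -> divides f g.
Proof.
elim=> [v vu|x a px _ IH] f g u pf.
  move=> e; exists (v^-1%:P * u); rewrite -mulrA -e mulrA -polyCM mulVr //.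
  by rewrite mul1r.
rewrite polyCM => e; have [x0 _ xP] := prime_polyC px.
have [|[v ev]|/(pf _ px)//] := xP u f.
  by rewrite -e -mulrA mulrC; exists (a%:P * g).
apply: (IH _ _ v) => //; apply: (mulfI x0).
by rewrite mulrA e ev mulrAC mulrC.
Qed.

Section Gauss.
Import Pdiv.Idomain.

(** Here [%|], [coprimep] and [irreducible_poly] are up to nonzero constants of [A], as
    over its fraction field; primitivity turns them into divisibility over [A]. *)
Lemma primitive_irreducible_prime (A : idomainType) (f : {poly A}) :
  factorial_domain A -> primitive_poly f -> irreducible_poly f -> prime_element f.
Proof.
move=> UA pf irr; split; first exact: irredp_neq0.
  by rewrite poly_unitE; case: irr => /gtn_eqF ->.
have descend k : f %| k -> divides f k.
  move=> /dvdpP[[c q]] /= c0; rewrite -mul_polyC.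
  exact: primitive_cancel (UA _ c0) _ _ _ pf.
move=> g h [u e]; have fgh : f %| g * h by rewrite e dvdp_mull.
have [cfg|/negP ncfg] := boolP (coprimep f g).
  by right; apply: descend; rewrite -(Gauss_dvdpr _ cfg).
left; apply: descend; rewrite -(eqp_dvdl _ (irr _ _ (dvdp_gcdl f g))) ?dvdp_gcdr //.
exact/negP.
Qed.

(** Induction on the size, after splitting off the content. A primitive [g] of positive degree is
    irreducible, hence prime, or it splits into shorter polynomials. *)
Lemma factorial_poly (A : idomainType) :
  factorial_domain A -> factorial_domain {poly A}.
Proof.
move=> UA f; have [k] := ubnP (size f); elim: k f => // k IH f; rewrite ltnS => sf f0.
have lc0_f : lead_coef f != 0 by rewrite lead_coef_eq0.
have [|c [g [ef pg]]] := primitive_part (UA _ lc0_f) (f := f).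
  by move=> c [u ->]; exists (lead_coef u); rewrite lead_coefM lead_coefC.
have c0 : c != 0 by apply: contra_neq f0 => c0; rewrite ef c0 mul0r.
have g0 : g != 0 by apply: contra_neq f0 => g0; rewrite ef g0 mulr0.
have sg : (size g <= k)%N by move: sf; rewrite ef mul_polyC size_scale.
rewrite ef; apply: prime_product_mul; first exact: prime_product_polyC (UA _ c0).
have [s1|s1] := leqP (size g) 1.
  rewrite (size1_polyC s1); apply/prime_product_polyC/UA.
  by rewrite -polyC_eq0 -size1_polyC.
have [irr|nirr] := EM (irreducible_poly g).
  rewrite -[g]mulr1; apply: prime_product_cons; first exact: primitive_irreducible_prime.
  by apply: prime_product_unit; rewrite unitr1.
have [q [sq1 qg nqg]] : exists q : {poly A}, [/\ size q != 1, q %| g & ~~ (q %= g)].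
  apply: contra_notP nirr => H; split=> // q sq qg; apply/negPn/negP => nqg.
  by apply: H; exists q.
have /dvdpP[[a h] /= a0 eah] := qg.
have ag0 : h * q != 0 by rewrite -eah -size_poly_gt0 size_scale // size_poly_gt0.
have [h0 q0] : h != 0 /\ q != 0 by apply/andP; rewrite -negb_or -mulf_eq0.
have sgE : (size g).+1 = (size h + size q)%N.
  have := size_mul h0 q0; rewrite -eah size_scale // => ->; rewrite prednK //.
  by rewrite addn_gt0 size_poly_gt0 h0.
have sq : (1 < size q)%N by rewrite ltn_neqAle eq_sym sq1 size_poly_gt0.
have sh : (1 < size h)%N.
  rewrite ltnNge; apply: contra nqg => sh1; apply/eqpP; exists (h`_0, a).
    by rewrite a0 andbT -polyC_eq0 -size1_polyC.
  by rewrite /= eah [in RHS](size1_polyC sh1) mul_polyC.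
have lc0_h : lead_coef h != 0 by rewrite lead_coef_eq0.
have [|c1 [h' [eh ph]]] := primitive_part (UA _ lc0_h) (f := h).
  by move=> z [u ->]; exists (lead_coef u); rewrite lead_coefM lead_coefC.
have lc0_q : lead_coef q != 0 by rewrite lead_coef_eq0.
have [|c2 [q' [eq pq]]] := primitive_part (UA _ lc0_q) (f := q).
  by move=> z [u ->]; exists (lead_coef u); rewrite lead_coefM lead_coefC.
have c10 : c1 != 0 by apply: contra_neq h0 => c10; rewrite eh c10 mul0r.
have c20 : c2 != 0 by apply: contra_neq q0 => c20; rewrite eq c20 mul0r.
have sh' : size h = size h' by rewrite eh mul_polyC size_scale.
have sq' : size q = size q' by rewrite eq mul_polyC size_scale.
have phq : primitive_poly (h' * q').
  by move=> x px; have [_ _ xP] := prime_polyC px; case/xP; [apply: ph|apply: pq].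
(* The splitting of [g] is known only up to the constant [a], which cancels because [h' * q'] is
   primitive. Comparing sizes shows that [u] is a constant. *)
have [u eu] : divides (h' * q') g.
  apply: (primitive_cancel (UA _ a0) (u := (c1 * c2)%:P)) => //.
  by rewrite mul_polyC eah eh eq polyCM mulrACA.
have u0 : u != 0 by apply: contra_neq g0 => u0; rewrite eu u0 mul0r.
have h'0 : h' != 0 by rewrite -size_poly_gt0 -sh' ltnW.
have q'0 : q' != 0 by rewrite -size_poly_gt0 -sq' ltnW.
have suE : size g = (size u + (size h' + size q').-1).-1.
  by rewrite eu size_mul ?mulf_neq0 // size_mul.
have su : (0 < size u)%N by rewrite size_poly_gt0.
have [suk shk sqk] : [/\ (size u < k)%N, (size h' < k)%N & (size q' < k)%N].
  rewrite sh' in sgE sh; rewrite sq' in sgE sq.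
  move: sh sq sgE suE sg su; clear.
  move: (size u) (size h') (size q') (size g) => a b c m *; split; lia.
by rewrite eu; apply: prime_product_mul; last apply: prime_product_mul; apply: IH.
Qed.
End Gauss.

(** Factoriality depends on multiplication alone, so a multiplicative bijection transports it. *)
Lemma factorial_iso (A B : idomainType) (f : A -> B) (g : B -> A) :
  {morph f : x y / x * y} -> cancel f g -> cancel g f ->
  factorial_domain A -> factorial_domain B.
Proof.
move=> fM fK gK UA b b0.
have f1 : f 1 = 1 by rewrite -[LHS]mulr1 -{1}(gK 1) -fM mul1r gK.
have f0 : f 0 = 0 by rewrite -[in LHS](mul0r (g 0)) fM gK mulr0.
have gM x y : g (x * y) = g x * g y by apply: (can_inj fK); rewrite fM !gK.
have g1 : g 1 = 1 by rewrite -f1 fK.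
have unitf x : x \is a GRing.unit -> f x \is a GRing.unit.
  by move=> /divrr xx; apply/unitrPr; exists (f x^-1); rewrite -fM xx.
have unitg x : x \is a GRing.unit -> g x \is a GRing.unit.
  by move=> /divrr xx; apply/unitrPr; exists (g x^-1); rewrite -gM xx.
have : prime_product (g b).
  by apply: UA; apply: contra_neq b0 => gb0; rewrite -(gK b) gb0 f0.
rewrite -{2}(gK b); elim=> [u uu|x a [x0 xu xP] _ IH].
  exact/prime_product_unit/unitf.
rewrite fM; apply: prime_product_cons => //; split.
- by apply: contra_neq x0 => fx0; rewrite -(fK x) fx0 -f0 fK.
- by apply: contra xu => /unitg; rewrite fK.
- move=> c d [u e]; have [|[v ev]|[v ev]] := xP (g c) (g d).
  + by exists (g u); rewrite -gM e gM fK.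
  + by left; exists (f v); rewrite -fM -ev gK.
  + by right; exists (f v); rewrite -fM -ev gK.
Qed.

(** * Multivariate polynomials by recursion on the variables *)

(** With this uniqueness principle, the evaluation identities below need checking only on constants
    and variables. *)
Lemma mpoly_rmorph_eq (n : nat) (A : comNzRingType) (S : nzRingType)
    (f g : {rmorphism {mpoly A[n]} -> S}) :
  (forall c, f c%:MP = g c%:MP) -> (forall i, f 'X_i = g 'X_i) -> f =1 g.
Proof.
move=> eC eX p; rewrite (mpolyE p) !rmorph_sum; apply: eq_bigr => m _.
rewrite -mul_mpolyC !rmorphM eC mpolyXE_id !rmorph_prod; congr (_ * _).
by apply: eq_bigr => i _; rewrite !rmorphXn eX.
Qed.

Section MpolyRec.
Variables (A : comNzRingType) (n : nat).

Definition mpoly_to_poly_var (i : 'I_n.+1) : {poly {mpoly A[n]}} :=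
  if unlift ord0 i is Some j then ('X_j)%:P else 'X.

Definition mpoly_to_poly : {mpoly A[n.+1]} -> {poly {mpoly A[n]}} :=
  mmap (polyC \o @mpolyC n A) mpoly_to_poly_var.

HB.instance Definition _ := GRing.RMorphism.copy mpoly_to_poly
  (mmap (polyC \o @mpolyC n A) mpoly_to_poly_var).

Definition mpoly_shift : {mpoly A[n]} -> {mpoly A[n.+1]} :=
  mmap (@mpolyC n.+1 A) (fun j => 'X_(lift ord0 j)).

HB.instance Definition _ := GRing.RMorphism.copy mpoly_shift
  (mmap (@mpolyC n.+1 A) (fun j => 'X_(lift ord0 j))).

Definition mpoly_of_poly : {poly {mpoly A[n]}} -> {mpoly A[n.+1]} :=
  horner_eval 'X_ord0 \o map_poly mpoly_shift.

HB.instance Definition _ := GRing.RMorphism.copy mpoly_of_poly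
  (horner_eval 'X_ord0 \o map_poly mpoly_shift).

Lemma mpoly_of_polyC c : mpoly_of_poly c%:P = mpoly_shift c.
Proof. by rewrite /mpoly_of_poly /= /horner_eval map_polyC hornerC. Qed.
Lemma mpoly_of_polyX : mpoly_of_poly 'X = 'X_ord0.
Proof. by rewrite /mpoly_of_poly /= /horner_eval map_polyX hornerX. Qed.

Lemma mpoly_to_polyX i : mpoly_to_poly 'X_i = mpoly_to_poly_var i.
Proof. by rewrite /mpoly_to_poly mmapX mmap1U. Qed.

Lemma mpoly_to_polyC c : mpoly_to_poly c%:MP = c%:MP%:P.
Proof. by rewrite /mpoly_to_poly mmapC. Qed.

Lemma mpoly_shiftX j : mpoly_shift 'X_j = 'X_(lift ord0 j).
Proof. by rewrite /mpoly_shift mmapX mmap1U. Qed.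

Lemma mpoly_shiftC c : mpoly_shift c%:MP = c%:MP.
Proof. by rewrite /mpoly_shift mmapC. Qed.

Lemma mpoly_of_polyK : cancel mpoly_of_poly mpoly_to_poly.
Proof.
elim/poly_ind=> [|P c IH].
  by rewrite !rmorph0.
rewrite !rmorphD !rmorphM /= mpoly_of_polyC mpoly_of_polyX.
rewrite IH mpoly_to_polyX /mpoly_to_poly_var unlift_none; congr (_ + _).
apply: (mpoly_rmorph_eq (f := mpoly_to_poly \o mpoly_shift) (g := @polyC _)) => [a|i] /=.
  by rewrite mpoly_shiftC mpoly_to_polyC.
by rewrite mpoly_shiftX mpoly_to_polyX /mpoly_to_poly_var liftK.
Qed.

Lemma mpoly_to_polyK : cancel mpoly_to_poly mpoly_of_poly.
Proof.
apply: (mpoly_rmorph_eq (f := mpoly_of_poly \o mpoly_to_poly) (g := idfun)) => [a|i] /=.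
  by rewrite mpoly_to_polyC mpoly_of_polyC mpoly_shiftC.
rewrite mpoly_to_polyX /mpoly_to_poly_var; case: unliftP => [j|] ->.
  by rewrite mpoly_of_polyC mpoly_shiftX.
exact: mpoly_of_polyX.
Qed.

Lemma meval_mpoly_to_poly (v : 'I_n.+1 -> A) (p : {mpoly A[n.+1]}) :
  p.@[v] = (map_poly (meval (v \o lift ord0)) (mpoly_to_poly p)).[v ord0].
Proof.
pose g := horner_eval (v ord0) \o map_poly (meval (v \o lift ord0)) \o mpoly_to_poly.
apply: (mpoly_rmorph_eq (f := meval v) (g := g)) => [a|i] /=.
  by rewrite mpoly_to_polyC /horner_eval map_polyC hornerC /= !mevalC.
rewrite mpoly_to_polyX /mpoly_to_poly_var /horner_eval mevalXU; case: unliftP => [j|] ->.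
  by rewrite map_polyC hornerC /= mevalXU.
by rewrite map_polyX hornerX.
Qed.

End MpolyRec.

(** Over an integral domain these are exactly the infinite subsets. *)
Definition zariski_dense (A : nzRingType) (S : A -> Prop) : Prop :=
  forall h : {poly A}, (forall x, S x -> h.[x] = 0) -> h = 0.

Lemma mpoly_novarE (A : nzRingType) (f : {mpoly A[0]}) : f = (f@_0)%:MP.
Proof.
apply/mpolyP => m; rewrite mcoeffC; have -> : m = 0%MM by apply/mnmP => -[].
by rewrite eqxx mulr1.
Qed.

(** Once the other coordinates are fixed, the polynomial in the first one vanishes on a dense set,
    so each of its coefficients vanishes at those coordinates; induction applies to the
    coefficients. *)
Lemma mpoly_eq0_on_product (A : comNzRingType) (n : nat) (S : 'I_n -> A -> Prop)
    (f : {mpoly A[n]}) :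
  (forall j, zariski_dense (S j)) ->
  (forall v, (forall j, S j (v j)) -> f.@[v] = 0) -> f = 0.
Proof.
elim: n S f => [|n IH] S f dS f0.
  have := f0 (fun=> 0); rewrite (mpoly_novarE f) mevalC => ->; first by rewrite mpolyC0.
  by case.
apply: (can_inj (@mpoly_to_polyK A n)); rewrite rmorph0; apply/polyP => i.
rewrite coef0; apply: (IH (fun j => S (lift ord0 j))) => [j|v Sv]; first exact: dS.
suff /polyP/(_ i) : map_poly (meval v) (mpoly_to_poly f) = 0 by rewrite coef_map coef0.
apply: (dS ord0) => x Sx.
pose w i := if unlift ord0 i is Some j then v j else x.
have -> : x = w ord0 by rewrite /w unlift_none.
have ew : v =1 w \o lift ord0 by move=> j; rewrite /w /= liftK.
rewrite (eq_map_poly (fun g => meval_eq g ew)) -meval_mpoly_to_poly; apply: f0 => j.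
by rewrite /w; case: unliftP => [k|] ->.
Qed.

Lemma factorial_mpoly (F : fieldType) (n : nat) : factorial_domain {mpoly F[n]}.
Proof.
elim: n => [|n IH].
  move=> f f0; apply: prime_product_unit; apply/unitrPr; exists (f@_0)^-1%:MP.
  rewrite {1}(mpoly_novarE f) -mpolyCM divff ?mpolyC1 //.
  by apply: contra_neq f0 => f0; rewrite (mpoly_novarE f) f0 mpolyC0.
have fM : {morph @mpoly_of_poly F n : x y / x * y} by exact: rmorphM.
apply: (factorial_iso fM (@mpoly_of_polyK F n) (@mpoly_to_polyK F n)).
exact: factorial_poly.
Qed.

(** * Slices through the origin and coprimality *)

Definition cone_var (F : comNzRingType) (n : nat) (i : 'I_n) : {poly {mpoly F[n]}} :=
  ('X_i)%:P * 'X.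

(** [cone p] is [p (t X)], a polynomial in [t] with coefficients in [F[X]]. *)
Definition cone (F : comNzRingType) (n : nat) : {mpoly F[n]} -> {poly {mpoly F[n]}} :=
  mmap (polyC \o @mpolyC n F) (@cone_var F n).

HB.instance Definition _ (F : comNzRingType) (n : nat) :=
  GRing.RMorphism.copy (@cone F n) (mmap (polyC \o @mpolyC n F) (@cone_var F n)).

Lemma coneC (F : comNzRingType) (n : nat) (c : F) : cone (c%:MP : {mpoly F[n]}) = c%:MP%:P.
Proof. by rewrite /cone mmapC. Qed.

Lemma coneX (F : comNzRingType) (n : nat) (i : 'I_n) :
  cone ('X_i : {mpoly F[n]}) = ('X_i)%:P * 'X.
Proof. by rewrite /cone mmapX mmap1U. Qed.

(** [slice w p] is [p (t w)], a polynomial in [t]. *)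
Definition slice (F : comNzRingType) (n : nat) (w : 'I_n -> F) : {mpoly F[n]} -> {poly F} :=
  map_poly (meval w) \o @cone F n.

HB.instance Definition _ (F : comNzRingType) (n : nat) (w : 'I_n -> F) :=
  GRing.RMorphism.copy (slice w) (map_poly (meval w) \o @cone F n).

Lemma slice_horner (F : comNzRingType) (n : nat) (w : 'I_n -> F) (p : {mpoly F[n]}) (t : F) :
  (slice w p).[t] = p.@[fun i => t * w i].
Proof.
apply: (mpoly_rmorph_eq (f := horner_eval t \o slice w)
  (g := meval (fun i => t * w i))) => [c|i] /=.
  by rewrite /horner_eval /slice /= coneC map_polyC hornerC /= !mevalC.
rewrite /horner_eval /slice /= coneX rmorphM /= map_polyC map_polyX hornerM hornerC hornerX.
by rewrite /= !mevalXU mulrC.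
Qed.

Section ConeCoprime.
Import Pdiv.Idomain.

Lemma prime_factor_of_positive_degree (A : idomainType) (g : {poly A}) :
  prime_product g -> (1 < size g)%N ->
  exists2 x, prime_element x & divides x g /\ (1 < size x)%N.
Proof.
elim=> [u|x a px _ IH].
  by rewrite poly_unitE => /andP[/eqP ->].
have [x0 _ _] := px; have [s1|s1 sxa] := ltnP 1 (size x).
  by move=> _; exists x => //; split=> //; exists a; rewrite mulrC.
have [|y py [[u eu] sy]] := IH.
  by move: sxa; rewrite (size1_polyC s1) mul_polyC size_scale // -polyC_eq0 -size1_polyC.
by exists y => //; split=> //; exists (x * u); rewrite eu mulrA.
Qed.

(** [g %| f] only makes some nonzero constant multiple [c *: f] a multiple of [g]. Having positive
    degree, the prime [x] cannot divide that constant, so it divides [f]. *)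
Lemma prime_divides_of_dvdp (A : idomainType) (x g f : {poly A}) :
  prime_element x -> (1 < size x)%N -> divides x g -> g %| f -> divides x f.
Proof.
move=> [_ _ xP] sx [a ea] /dvdpP[[c u] /= c0 e].
have [|[v ev]|//] := xP c%:P f; first by exists (u * a); rewrite mul_polyC e ea mulrA.
have cP0 : c%:P != 0 :> {poly A} by rewrite polyC_eq0.
have : (size x <= size c%:P)%N by apply: dvdp_leq => //; rewrite ev dvdp_mull.
by rewrite size_polyC c0 leqNgt sx.
Qed.

Lemma common_prime_factor (A : idomainType) (P Q : {poly A}) :
  factorial_domain {poly A} -> P != 0 -> ~~ coprimep P Q ->
  exists x : {poly A}, [/\ prime_element x, (1 < size x)%N, divides x P & divides x Q].
Proof.
move=> UP P0 ncop.
have g0 : gcdp P Q != 0 by rewrite gcdp_eq0 negb_and P0.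
have sg : (1 < size (gcdp P Q))%N.
  by rewrite ltn_neqAle eq_sym size_poly_gt0 g0 andbT.
have [x px [xg sx]] := prime_factor_of_positive_degree (UP _ g0) sg.
exists x; split=> //; first exact: prime_divides_of_dvdp px sx xg (dvdp_gcdl _ _).
exact: prime_divides_of_dvdp px sx xg (dvdp_gcdr _ _).
Qed.

(** Otherwise the two cones share a prime [x] of positive degree in [t]. For each [s != 0], [tau]
    turns [x] into a common factor of [p] and [q], hence a constant; so the value of [x] at [(w, s)]
    does not depend on [w]. It can be computed at [w = 0], where the cone of [p] is a nonzero
    constant. *)
Lemma cone_coprime (F : fieldType) (n : nat) (p q : {mpoly F[n]}) :
  zariski_dense (fun x : F => x != 0) -> p.@[fun=> 0] != 0 ->
  (forall f g h : {mpoly F[n]}, p = f * g -> q = f * h -> exists c, f = c%:MP) ->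
  coprimep (cone p) (cone q).
Proof.
move=> dF p0 ncf; apply/negPn/negP => ncop.
have sliceP : slice (fun=> 0) p = (p.@[fun=> 0])%:P.
  apply/eqP; rewrite -subr_eq0; apply/eqP/dF => x _.
  rewrite hornerD hornerN hornerC slice_horner; apply/eqP; rewrite subr_eq0; apply/eqP.
  by apply: meval_eq => i; rewrite mulr0.
have P0 : cone p != 0.
  apply: contra_neq p0 => P0; apply/eqP; rewrite -polyC_eq0 -sliceP /slice /=.
  by rewrite P0 rmorph0.
have UP : factorial_domain {poly {mpoly F[n]}} by apply/factorial_poly/factorial_mpoly.
have [x [px sx [a ea] [b eb]]] := common_prime_factor UP P0 ncop.
have x_slice w s : s != 0 ->
    (map_poly (meval w) x).[s] = (map_poly (meval (fun=> 0)) x).[s].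
  move=> s0.
  (* [tau] substitutes [X / s] for [X] and [s] for [t]. *)
  pose sub := mmap (@mpolyC n F) (fun i : 'I_n => s^-1 *: 'X_i : {mpoly F[n]}).
  pose tau := sub \o horner_eval (s%:MP : {mpoly F[n]}).
  have tauM : {morph tau : f g / f * g}.
    by move=> f g; rewrite /tau /= /horner_eval hornerM /sub rmorphM.
  have tau_cone f : tau (cone f) = f.
    apply: (mpoly_rmorph_eq (f := tau \o @cone F n) (g := idfun)) => [c|i] /=.
      by rewrite coneC /horner_eval hornerC /sub mmapC.
    rewrite coneX /horner_eval hornerM hornerC hornerX /sub rmorphM /= mmapX mmapC mmap1U.
    by rewrite mulrC mul_mpolyC scalerA divff // scale1r.
  have tau_eval H v : (tau H).@[v] = (map_poly (meval (fun i => s^-1 * v i)) H).[s].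
    have := horner_map (meval (fun i => s^-1 * v i)) H s%:MP; rewrite /= mevalC => ->.
    apply: (mpoly_rmorph_eq (f := meval v \o sub)
      (g := meval (fun i => s^-1 * v i))) => [c|i] /=.
      by rewrite /sub mmapC !mevalC.
    by rewrite /sub mmapX mmap1U mevalZ !mevalXU.
  have [c ec] : exists c, tau x = c%:MP.
    apply: (ncf _ (tau a) (tau b)); rewrite -[LHS]tau_cone mulrC.
      by rewrite ea tauM.
    by rewrite eb tauM.
  have := tau_eval x (fun i => s * w i); have := tau_eval x (fun i => 0).
  rewrite ec !mevalC => e1 e2.
  have ew : w =1 (fun i => s^-1 * (s * w i)) by move=> i; rewrite mulKf.
  have e0 : (fun=> 0) =1 (fun i : 'I_n => s^-1 * 0) by move=> i; rewrite mulr0.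
  rewrite (eq_map_poly (fun f => meval_eq f ew)) -e2.
  by rewrite (eq_map_poly (fun f => meval_eq f e0)) -e1.
have x_const w : map_poly (meval w) x = map_poly (meval (fun=> 0)) x.
  apply/eqP; rewrite -subr_eq0; apply/eqP/dF => s s0.
  by rewrite hornerD hornerN x_slice // subrr.
(* At [w = 0], [x] divides the nonzero constant [p.@[fun=> 0]], so it has degree 0 there, and by
   [x_const] for every [w]. *)
have sx1 : size (map_poly (meval (fun=> 0)) x) = 1%N.
  move: sliceP; rewrite /slice /= ea rmorphM => /(congr1 (fun p => size (p : {poly F}))).
  rewrite size_polyC p0 => /eqP; rewrite size_mul_eq1.
  by case/andP => _ /eqP.
suff : (size x <= 1)%N by rewrite leqNgt sx.
apply/leq_sizeP => i i1.
apply: (mpoly_eq0_on_product (S := fun _ y => y != 0)) => // w _.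
have <- : (map_poly (meval w) x)`_i = (x`_i).@[w] by rewrite coef_map.
by rewrite x_const nth_default // sx1.
Qed.

End ConeCoprime.

(** * Regularity and density on the torus *)

Lemma mpoly_generators_ind (A : nzRingType) (n : nat) (P : {mpoly A[n]} -> Prop) :
  (forall c, P c%:MP) -> (forall i, P 'X_i) ->
  (forall f g, P f -> P g -> P (f + g)) -> (forall f g, P f -> P g -> P (f * g)) ->
  forall f, P f.
Proof.
move=> PC PX PD PM f; rewrite (mpolyE f).
apply: (big_ind P) => // [|m _]; first by rewrite -mpolyC0.
rewrite -mul_mpolyC mpolyXE_id; apply: (PM) => //.
apply: (big_ind P) => // [|i _]; first by rewrite -mpolyC1.
by elim: (m i) => [|k IH]; rewrite ?expr0 -?mpolyC1 // exprS; apply: PM.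
Qed.

Lemma meval_torus_lipschitz (C : numDomainType) (n : nat) (f : {mpoly C[n]}) :
  exists2 K : C, 0 <= K & forall (v w : 'I_n -> C) (e : C),
    (forall j, `|v j| = 1) -> (forall j, `|w j| = 1) ->
    (forall j, `|v j - w j| <= e) -> 0 <= e -> `|f.@[v] - f.@[w]| <= K * e.
Proof.
(* The induction also carries a bound [B] on the torus, which the Lipschitz estimate of a product
   requires. *)
suff [B [K [B0 K0 HB HK]]] : exists B K : C, [/\ 0 <= B, 0 <= K,
    forall v : 'I_n -> C, (forall j, `|v j| = 1) -> `|f.@[v]| <= B
  & forall (v w : 'I_n -> C) (e : C),
    (forall j, `|v j| = 1) -> (forall j, `|w j| = 1) ->
    (forall j, `|v j - w j| <= e) -> 0 <= e -> `|f.@[v] - f.@[w]| <= K * e].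
  by exists K.
elim/mpoly_generators_ind: f => [c|i|f g|f g].
- exists `|c|, 0; split=> // [v _|v w e _ _ _ e0]; first by rewrite mevalC.
  by rewrite !mevalC subrr normr0 mul0r.
- exists 1, 1; split=> // [v v1|v w e _ _ vw e0]; first by rewrite mevalXU v1.
  by rewrite !mevalXU mul1r.
- move=> [B [K [B0 K0 HB HK]]] [B' [K' [B'0 K'0 HB' HK']]].
  exists (B + B'), (K + K'); split=> [||v v1|v w e v1 w1 vw e0]; rewrite ?addr_ge0 //.
    by rewrite mevalD (le_trans (ler_normD _ _)) // lerD ?HB ?HB'.
  rewrite !mevalD opprD addrACA mulrDl (le_trans (ler_normD _ _)) // lerD //.
    exact: HK.
  exact: HK'.
- move=> [B [K [B0 K0 HB HK]]] [B' [K' [B'0 K'0 HB' HK']]].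
  exists (B * B'), (B * K' + B' * K).
  split=> [||v v1|v w e v1 w1 vw e0]; rewrite ?addr_ge0 ?mulr_ge0 //.
    by rewrite mevalM normrM ler_pM // ?HB ?HB'.
  have -> : (f * g).@[v] - (f * g).@[w] =
      f.@[v] * (g.@[v] - g.@[w]) + g.@[w] * (f.@[v] - f.@[w]).
    by rewrite !mevalM; ring.
  rewrite mulrDl -!mulrA (le_trans (ler_normD _ _)) // lerD // normrM ler_pM //.
  + exact: HB.
  + exact: HK'.
  + exact: HB'.
  + exact: HK.
Qed.

Lemma zariski_dense_arc (C : numClosedFieldType) (a e : C) :
  `|a| = 1 -> 0 < e -> zariski_dense (fun t : C => `|t| = 1 /\ `|t - a| < e).
Proof.
move=> a1 e0 h hS; apply/eqP/negPn/negP => h0.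
have ie : 'i ^+ 2 = -1 :> C by rewrite sqrCi.
(* The shift by 3 gives [2 * s k < e], the bound on the distance from [t k] to [a] below. *)
pose s (k : nat) : C := e / (k + 3)%:R.
have s0 k : 0 < s k by rewrite divr_gt0 // ltr0n addn3.
have s_small k : 2 * s k < e.
  rewrite /s mulrA ltr_pdivrMr ?ltr0n ?addn3 // [2 * e]mulrC ltr_pM2l // ltr_nat.
  by rewrite !ltnS.
have s_inj : injective s.
  move=> k l /(mulfI (lt0r_neq0 e0)) /invr_inj /eqP.
  by rewrite eqr_nat eqn_add2r => /eqP.
clearbody s.
have sR k : (s k)^* = s k by apply/CrealP/gtr0_real.
have den_norm k : `|1 - 'i * s k| ^+ 2 = 1 + s k ^+ 2.
  rewrite normCK rmorphB rmorphM /= rmorph1 conjCi sR.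
  by transitivity (1 - 'i ^+ 2 * s k ^+ 2); [ring | rewrite ie; ring].
have num_norm k : `|1 + 'i * s k| ^+ 2 = 1 + s k ^+ 2.
  rewrite normCK rmorphD rmorphM /= rmorph1 conjCi sR.
  by transitivity (1 - 'i ^+ 2 * s k ^+ 2); [ring | rewrite ie; ring].
have den_ge1 k : 1 <= `|1 - 'i * s k|.
  rewrite -(@ler_pXn2r _ 2) ?nnegrE // den_norm expr1n lerDl.
  by rewrite exprn_ge0 // ltW.
have den0 k : 1 - 'i * s k != 0 by rewrite -normr_gt0 (lt_le_trans ltr01).
(* The Cayley transform of the real points [s k]. *)
pose t (k : nat) : C := a * ((1 + 'i * s k) / (1 - 'i * s k)).
have tS k : `|t k| = 1 /\ `|t k - a| < e.
  split.
    rewrite /t normrM a1 mul1r normrM normfV; suff -> : `|1 + 'i * s k| = `|1 - 'i * s k|.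
      by rewrite divff // normr_eq0.
    by apply/eqP; rewrite -(eqrXn2 (n := 2)) // num_norm den_norm.
  have -> : t k - a = a * (2 * 'i * s k) / (1 - 'i * s k) by rewrite /t; field.
  rewrite !normrM a1 normCi normfV (gtr0_norm (s0 k)) normr_nat mul1r mulr1.
  rewrite ltr_pdivrMr ?(lt_le_trans ltr01) //.
  by apply: (lt_le_trans (s_small k)); rewrite ler_peMr // ltW.
have t_inj : injective t.
  move=> k l; have a0 : a != 0 by rewrite -normr_eq0 a1 oner_eq0.
  move=> /(mulfI a0) /eqP; rewrite eqr_div // => /eqP E.
  have : s k = s l.
    have i0 : 2 * 'i != 0 :> C by rewrite mulf_neq0 ?neq0Ci // pnatr_eq0.
    apply: (mulfI i0); apply/eqP; rewrite -subr_eq0; apply/eqP.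
    rewrite -[RHS](subrr ((1 + 'i * s k) * (1 - 'i * s l))) {2}E.
    by ring.
  exact: s_inj.
have /(max_poly_roots h0) : all (root h) (map t (iota 0 (size h))).
  by apply/allP => _ /mapP[k _ ->]; apply/eqP; exact: (hS _ (tS k)).
by rewrite map_inj_uniq // iota_uniq size_map size_iota ltnn => /(_ isT).
Qed.

(** * Reflection and Blaschke products *)

(** The difference of the squared moduli factors as [(|r|^2 - 1) (1 - |t|^2)], whose second factor
    is positive. *)
Lemma blaschke_factor_le (C : numClosedFieldType) (r t : C) :
  1 <= `|r| -> `|t| < 1 -> `|1 - r^* * t| <= `|t - r| ?= iff (`|r| == 1).
Proof.
move=> r1 t1.
have E : `|t - r| ^+ 2 - `|1 - r^* * t| ^+ 2 = (`|r| ^+ 2 - 1) * (1 - `|t| ^+ 2).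
  rewrite !normCK !rmorphB !rmorphM rmorph1 /= conjCK; ring.
have t2 : 0 < 1 - `|t| ^+ 2 by rewrite subr_gt0 expr_lt1.
have r2 : 0 <= `|r| ^+ 2 - 1 by rewrite subr_ge0 exprn_ege1.
split.
  by rewrite -(@ler_pXn2r _ 2) ?nnegrE // -subr_ge0 E mulr_ge0 // ltW.
rewrite -(eqrXn2 (n := 2)) // eq_sym -subr_eq0 E mulf_eq0 (gt_eqF t2) orbF subr_eq0.
by rewrite sqrp_eq1.
Qed.

(** Every factor gives a weak inequality; the last hypothesis supplies a strict one, from a positive
    power of [|t|] or from a root off the circle. *)
Lemma blaschke_product_lt (C : numClosedFieldType) (rs : seq C) (t : C) (k : nat) :
  (forall r, r \in rs -> 1 <= `|r|) -> t != 0 -> `|t| < 1 ->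
  (0 < k)%N || has (fun r => `|r| != 1) rs ->
  `|t| ^+ k * \prod_(r <- rs) `|1 - r^* * t| < \prod_(r <- rs) `|t - r|.
Proof.
move=> + t0 t1.
have nt0 : 0 < `|t| by rewrite normr_gt0.
have pos r : 1 <= `|r| -> 0 < `|t - r|.
  by move=> r1; rewrite normr_gt0 subr_eq0; apply: contraTneq r1 => <-; rewrite lt_geF.
elim: rs => [_|r rs IH ge1].
  by rewrite orbF => k0; rewrite !big_nil mulr1 expr_lt1.
have r1 : 1 <= `|r| by apply: ge1; rewrite mem_head.
have {}ge1 s : s \in rs -> 1 <= `|s| by move=> srs; apply: ge1; rewrite in_cons srs orbT.
have ppos : 0 < \prod_(s <- rs) `|t - s|.
  by rewrite big_seq prodr_gt0 // => s /ge1 /pos.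
have ple : \prod_(s <- rs) `|1 - s^* * t| <= \prod_(s <- rs) `|t - s|.
  rewrite big_seq [leRHS]big_seq ler_prod // => s /ge1 s1.
  by rewrite normr_ge0 (blaschke_factor_le s1 t1).
rewrite /= !big_cons orbCA mulrCA => /orP[rn1|H].
  apply: (@le_lt_trans _ _ (`|1 - r^* * t| * \prod_(s <- rs) `|t - s|)).
    rewrite ler_wpM2l // (le_trans _ ple) // ler_piMl ?prodr_ge0 //.
    by rewrite exprn_ile1 // ltW.
  by rewrite ltr_pM2r // (lt_leif (blaschke_factor_le r1 t1)).
apply: (@le_lt_trans _ _ (`|t - r| * (`|t| ^+ k * \prod_(s <- rs) `|1 - s^* * t|))).
  rewrite ler_wpM2r ?mulr_ge0 ?exprn_ge0 ?prodr_ge0 //.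
  by rewrite (blaschke_factor_le r1 t1).
by rewrite ltr_pM2l ?pos // IH.
Qed.

Lemma prodr_ge1_eq1 (C : numDomainType) (rs : seq C) :
  (forall r, r \in rs -> 1 <= `|r|) -> \prod_(r <- rs) `|r| <= 1 ->
  forall r, r \in rs -> `|r| = 1.
Proof.
elim: rs => // s rs IH ge1; rewrite big_cons => le1.
have s1 : 1 <= `|s| by apply: ge1; rewrite mem_head.
have {}ge1 r : r \in rs -> 1 <= `|r| by move=> rrs; apply: ge1; rewrite in_cons rrs orbT.
have p1 : 1 <= \prod_(r <- rs) `|r|.
  elim: rs ge1 {IH le1} => [_|x rs IH ge1]; first by rewrite big_nil.
  rewrite big_cons mulr_ege1 ?ge1 ?mem_head // IH // => r rrs.
  by apply: ge1; rewrite in_cons rrs orbT.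
have s_le : `|s| <= 1 by apply: le_trans le1; rewrite ler_peMr.
have p_le : \prod_(r <- rs) `|r| <= 1.
  by apply: le_trans le1; rewrite ler_peMl // (le_trans ler01).
move=> r; rewrite in_cons => /orP[/eqP ->|]; first by apply/eqP; rewrite eq_le s_le.
exact: IH.
Qed.

Section Slices.
Variables (C : comNzRingType) (n : nat).
Implicit Types (p f : {mpoly C[n]}) (w : 'I_n -> C) (m N : 'X_{1..n}).

Definition multidegree_le f N : Prop := forall m, m \in msupp f -> (m <= N)%MM.

Lemma slice_mpolyX w m : slice w 'X_[m] = ('X_[m].@[w]) *: 'X^(mdeg m).
Proof.
rewrite /slice /= mpolyXE_id rmorph_prod.
under eq_bigr => i _ do rewrite rmorphXn /= coneX exprMn -rmorphXn.
rewrite big_split /= -rmorph_prod prodrXr rmorphM /= map_polyC map_polyXn /= mul_polyC.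
by rewrite mdegE.
Qed.

(** The coefficient of [t^k] is the homogeneous component of degree [k], evaluated at [w]. *)
Lemma slice_coef w f k :
  (slice w f)`_k = \sum_(m <- msupp f | mdeg m == k) f@_m * 'X_[m].@[w].
Proof.
rewrite {1}(mpolyE f) rmorph_sum /= coef_sum [RHS]big_mkcond; apply: eq_bigr => m _.
rewrite -mul_mpolyC rmorphM /= /slice /= coneC map_polyC /= mevalC coefCM.
have := slice_mpolyX w m; rewrite /slice /= => ->; rewrite coefZ coefXn eq_sym.
by case: eqP; rewrite ?mulr1 ?mulr0.
Qed.

Lemma slice_size w f N : multidegree_le f N -> (size (slice w f) <= (mdeg N).+1)%N.
Proof.
move=> fN; apply/leq_sizeP => k kN; rewrite slice_coef big_seq_cond big1 //.
move=> m /andP[/fN mN /eqP mk]; move: kN; rewrite -mk ltnNge.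
by rewrite -(submK mN) mdegD leq_addl.
Qed.

(** Among the exponents below [N], only [N] itself has total degree [mdeg N]. On the torus the
    modulus of this coefficient is therefore independent of [w]. *)
Lemma slice_top_coef w f N : multidegree_le f N ->
  (slice w f)`_(mdeg N) = f@_N * 'X_[N].@[w].
Proof.
move=> fN; rewrite slice_coef big_seq_cond.
rewrite (eq_bigl (fun m => (m \in msupp f) && (m == N))); last first.
  move=> m; case: (boolP (m \in _)) => //= /fN mN; apply/idP/eqP => [/eqP e|->//].
  move: e; rewrite -{1 2}(submK mN) mdegD -[LHS]add0n => /addIn /esym /eqP.
  by rewrite mdeg_eq0 => /eqP ->; rewrite add0m.
rewrite -big_seq_cond big_mkcond /=; have [NS|NS] := boolP (N \in msupp f).
  by rewrite (bigD1_seq N) ?msupp_uniq //= eqxx big1 ?addr0 // => m /negbTE ->.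
rewrite (memN_msupp_eq0 NS) mul0r big_seq big1 // => m mf.
by case: eqP => // mN; rewrite -mN mf in NS.
Qed.

Lemma multidegree_leB p f N :
  multidegree_le p N -> multidegree_le f N -> multidegree_le (p - f) N.
Proof.
move=> pN fN m; rewrite mcoeff_msupp mcoeffB.
have [/pN //|/memN_msupp_eq0 ->] := boolP (m \in msupp p).
have [/fN //|/memN_msupp_eq0 ->] := boolP (m \in msupp f).
by rewrite subrr eqxx.
Qed.

Lemma multidegree_leZ c f N : multidegree_le f N -> multidegree_le (c *: f) N.
Proof.
move=> fN m; rewrite mcoeff_msupp mcoeffZ => cf; apply: fN; rewrite mcoeff_msupp.
by apply: contra_neq cf => ->; rewrite mulr0.
Qed.

Lemma meval_at0 f : f.@[fun=> 0] = f@_0.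
Proof.
apply: (mpoly_rmorph_eq (f := meval _) (g := mcoeff 0%MM)) => [c|i] /=.
  by rewrite mevalC mcoeffC eqxx mulr1.
by rewrite mevalXU mcoeffX -mdeg_eq0 mdeg1.
Qed.
End Slices.

Section Reflection.
Variables (C : numClosedFieldType) (n : nat).
Implicit Types (p f : {mpoly C[n]}) (w : 'I_n -> C) (m N : 'X_{1..n}).

(** Convertible to [reflect_poly], but stated over any numeric closed field. *)
Definition reflection N p : {mpoly C[n]} :=
  \sum_(m <- msupp p) (p@_m)^* *: 'X_[N - m].

Lemma reflection_coef N p m : multidegree_le p N -> (m <= N)%MM ->
  (reflection N p)@_m = (p@_(N - m))^*.
Proof.
move=> pN mN; rewrite raddf_sum /=.
under eq_bigr => k _ do rewrite mcoeffZ mcoeffX.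
(* Truncated subtraction from [N] is an involution on the exponents below [N]. *)
have eN k : (k <= N)%MM -> ((N - k)%MM == m) = (k == (N - m)%MM).
  move=> kN; apply/eqP/eqP => [<-|->]; apply/mnmP => i; rewrite !mnmBE;
  move/mnm_lepP/(_ i): kN; move/mnm_lepP/(_ i): mN; lia.
have [NS|NS] := boolP ((N - m)%MM \in msupp p).
  rewrite (bigD1_seq (N - m)%MM) ?msupp_uniq //= eN ?pN // eqxx mulr1.
  rewrite big_seq_cond big1 ?addr0 // => k /andP[/pN kN /negbTE ne].
  by rewrite eN // ne mulr0.
rewrite (memN_msupp_eq0 NS) rmorph0 big_seq big1 // => k kS.
rewrite eN ?pN //; case: eqP => [e|_]; last by rewrite mulr0.
by rewrite -e kS in NS.
Qed.

Lemma reflection_multidegree_le N p : multidegree_le (reflection N p) N.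
Proof.
move=> m; apply: contraTT => mN; rewrite mcoeff_msupp negbK raddf_sum /=.
apply/eqP; rewrite big1 // => k _; rewrite mcoeffZ mcoeffX.
case: eqP => [e|_]; last by rewrite mulr0.
by case/negP: mN; rewrite -e; apply/mnm_lepP => i; rewrite mnmBE leq_subr.
Qed.

Lemma reflection_meval N p (v : 'I_n -> C) : multidegree_le p N -> (forall j, v j != 0) ->
  (reflection N p).@[v] = 'X_[N].@[v] * (p.@[fun j => (v j)^-1^*])^*.
Proof.
move=> pN v0.
have -> : (reflection N p).@[v] = \sum_(m <- msupp p) ((p@_m)^* *: 'X_[N - m]).@[v].
  by rewrite -raddf_sum.
rewrite (mevalE (fun j => (v j)^-1^*) p) rmorph_sum mulr_sumr big_seq [RHS]big_seq.
apply: eq_bigr => m /pN mN; rewrite mevalZ rmorphM mulrCA; congr (_ * _).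
rewrite !mevalX rmorph_prod -big_split /=; apply: eq_bigr => i _.
rewrite rmorphXn /= conjCK mnmBE exprVn expfB_cond ?(negbTE (v0 i)) //=.
by move/mnm_lepP: mN; apply.
Qed.

End Reflection.

(** * Level sets on slices *)

Section StablePolynomial.
Variables (C : numClosedFieldType) (n : nat) (N : 'X_{1..n}) (p : {mpoly C[n]}).
Hypothesis p_stable : forall z, (forall j, `|z j| < 1) -> p.@[z] != 0.
Hypothesis pN : multidegree_le p N.
Implicit Types (w : 'I_n -> C) (t : C).

Lemma const_coef_neq0 : p@_0 != 0.
Proof. by rewrite -meval_at0 p_stable // => j; rewrite normr0. Qed.

Lemma norm_monomial w : (forall j, `|w j| = 1) -> `|'X_[N].@[w]| = 1.
Proof.
by move=> w1; rewrite mevalX normr_prod big1 // => j _; rewrite normrX w1 expr1n.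
Qed.

(** A root [r] with [|r| < 1] would put the zero [r w] of [p] in the polydisk. The last clause reads
    off the coefficient of degree [mdeg N], which is 0 when the slice has smaller degree. *)
Lemma slice_roots w : (forall j, `|w j| = 1) ->
  exists (c : C) (rs : seq C),
    [/\ c != 0, (forall r, r \in rs -> 1 <= `|r|),
        (forall t, p.@[fun j => t * w j] = c * \prod_(r <- rs) (t - r)),
        (size rs <= mdeg N)%N &
        p@_N * 'X_[N].@[w] = if size rs == mdeg N then c else 0].
Proof.
move=> w1; have [rs e] := closed_field_poly_normal (slice w p).
have ev t : p.@[fun j => t * w j] = lead_coef (slice w p) * \prod_(r <- rs) (t - r).
  rewrite -slice_horner {1}e hornerZ horner_prod; congr (_ * _).
  by apply: eq_bigr => r _; rewrite !hornerE.
have c0 : lead_coef (slice w p) != 0.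
  apply: contra_neq const_coef_neq0 => c0; rewrite -meval_at0.
  have := ev 0; rewrite c0 mul0r; apply: etrans; by apply: meval_eq => j; rewrite mul0r.
have srs : size (slice w p) = (size rs).+1 by rewrite e size_scale // size_prod_XsubC.
exists (lead_coef (slice w p)), rs; split=> //.
- move=> r rrs; rewrite real_leNgt ?normr_real ?real1 //; apply/negP => r1.
  have : p.@[fun j => r * w j] != 0 by apply: p_stable => j; rewrite normrM w1 mulr1.
  by case/eqP; rewrite ev (big_rem _ rrs) /= subrr mul0r mulr0.
- by rewrite -ltnS -srs slice_size.
- rewrite -slice_top_coef // lead_coefE srs /=.
  case: eqP => [->//|/eqP ne]; rewrite nth_default // srs ltn_neqAle ne.
  by rewrite -ltnS -srs slice_size.
Qed.

(** On the torus each [w j] is its own image under inversion in the circle, so only [t] gets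
    reflected. *)
Lemma reflection_slice w t : (forall j, `|w j| = 1) -> t != 0 ->
  (reflection N p).@[fun j => t * w j]
  = t ^+ mdeg N * 'X_[N].@[w] * (p.@[fun j => (t^-1)^* * w j])^*.
Proof.
move=> w1 t0; have w0 j : w j != 0 by rewrite -normr_eq0 w1 oner_eq0.
rewrite reflection_meval // => [|j]; last by rewrite mulf_neq0.
congr (_ * _^*).
  rewrite !mevalX mdegE -prodrXr -big_split /=.
  by apply: eq_bigr => j _; rewrite exprMn.
apply: meval_eq => j; rewrite invfM rmorphM /=; congr (_ * _).
by rewrite -[RHS]mul1r -[LHS]mulr1 invC_norm w1 expr1n invr1 mul1r conjCK mulr1 mul1r.
Qed.

(** On a slice, the equality of moduli makes the product of all [|r|] equal to 1, so every root lies
    on the circle. There the conjugate of [1 - r] is [- r^* (1 - r)], which makes [p] and its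
    reflection proportional on the torus, with a ratio independent of [w]. *)
Lemma extremal_reflection :
  `|p@_N| = `|p@_0| -> p@_N *: reflection N p = (p@_0)^* *: p.
Proof.
move=> top; apply/eqP; rewrite -subr_eq0; apply/eqP.
apply: (@mpoly_eq0_on_product C n (fun _ y => `|y| = 1)) => [_ h h0|w w1].
  by apply: (zariski_dense_arc (normr1 C) (@ltr01 C)) => t [t1 _]; apply: h0.
have [c [rs [c0 rs1 ev srs]]] := slice_roots w1.
have ev0 : p@_0 = c * \prod_(r <- rs) - r.
  rewrite -meval_at0 (_ : p.@[_] = p.@[fun j => 0 * w j]); last first.
    by apply: meval_eq => j; rewrite mul0r.
  by rewrite ev; under eq_bigr => r _ do rewrite sub0r.
have ev1 : p.@[w] = c * \prod_(r <- rs) (1 - r).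
  by rewrite -ev; apply: meval_eq => j; rewrite mul1r.
case: eqP => [_ pNc|_ pNc]; last first.
  have := top; rewrite -[`|p@_N|]mulr1 -(norm_monomial w1) -normrM pNc normr0 => /esym /eqP.
  by rewrite normr_eq0 (negbTE const_coef_neq0).
have rs_eq1 r : r \in rs -> `|r| = 1.
  apply: prodr_ge1_eq1 => //; rewrite -(@ler_pM2l _ `|c|) ?normr_gt0 // mulr1.
  rewrite -{2}pNc normrM norm_monomial // mulr1 top ev0 normrM normr_prod.
  by under [X in _ * X]eq_bigr => s _ do rewrite -normrN.
have E : (\prod_(r <- rs) (1 - r))^* = (\prod_(r <- rs) - r)^* * \prod_(r <- rs) (1 - r).
  rewrite !rmorph_prod -big_split big_seq [RHS]big_seq; apply: eq_bigr => r /rs_eq1 r1 /=.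
  have rr : r * r^* = 1 by rewrite -normCK r1 expr1n.
  rewrite rmorphB rmorphN rmorph1 /= -{1}rr; ring.
have := reflection_slice w1 (oner_neq0 C).
rewrite (_ : (reflection N p).@[_] = (reflection N p).@[w]); last first.
  by apply: meval_eq => j; rewrite mul1r.
rewrite invr1 conjC1 (_ : p.@[fun j => 1 * w j] = p.@[w]); last first.
  by apply: meval_eq => j; rewrite mul1r.
rewrite expr1n mul1r mevalB !mevalZ => ->.
rewrite mulrA pNc ev1 ev0 !rmorphM /= E; ring.
Qed.

Hypothesis top_neq : `|p@_N| != `|p@_0|.

(** Giving one factor [|t|] to each root turns the reflected slice into a product of [|1 - r^* t|]
    times a leftover power of [|t|]. Equality would need full degree and all roots on the circle,
    which [top_neq] excludes. *)
Lemma reflection_lt w t : (forall j, `|w j| = 1) -> t != 0 -> `|t| < 1 ->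
  `|(reflection N p).@[fun j => t * w j]| < `|p.@[fun j => t * w j]|.
Proof.
move=> w1 t0 t1; rewrite reflection_slice //.
have [c [rs [c0 rs1 ev srs top]]] := slice_roots w1.
rewrite !ev !normrM norm_conjC !normrM norm_monomial // mulr1 mulrCA ltr_pM2l ?normr_gt0 //.
rewrite !normr_prod normrX.
have -> : `|t| ^+ mdeg N * \prod_(r <- rs) `|(t^-1)^* - r| =
          `|t| ^+ (mdeg N - size rs) * \prod_(r <- rs) `|1 - r^* * t|.
  rewrite -{1}(subnK srs) exprD -mulrA; congr (_ * _).
  elim: rs {rs1 ev srs top} => [|r rs IH] /=; first by rewrite !big_nil mul1r.
  rewrite !big_cons exprS mulrACA IH; congr (_ * _).
  rewrite -[`|_ - r|]norm_conjC rmorphB /= conjCK -normrM; congr (`|_|).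
  by rewrite mulrBr divff // mulrC.
apply: blaschke_product_lt => //; rewrite subn_gt0 ltn_neqAle srs andbT.
case: eqP top => //= sN top; apply/negPn/negP => /hasPn rs_eq1.
case/negP: top_neq; apply/eqP.
have := ev 0; rewrite (_ : p.@[_] = p@_0); last first.
  by rewrite -meval_at0; apply: meval_eq => j; rewrite mul0r.
move=> ->; rewrite normrM normr_prod [X in _ * X]big_seq big1 ?mulr1; last first.
  by move=> r /rs_eq1; rewrite negbK sub0r normrN => /eqP.
by rewrite -top normrM norm_monomial // mulr1.
Qed.

(** At such a zero [p] and its reflection have equal moduli. This fails at [t = 0] by [top_neq] and
    for [0 < |t| < 1] by [reflection_lt]; for [|t| > 1] the same inequality is applied at the mirror
    point [s]. *)
Lemma level_zeros_on_circle (lam : C) w t : `|lam| = 1 -> (forall j, `|w j| = 1) ->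
  (reflection N p - lam *: p).@[fun j => t * w j] = 0 -> `|t| = 1.
Proof.
move=> lam1 w1; rewrite mevalB mevalZ => /subr0_eq E.
have En : `|(reflection N p).@[fun j => t * w j]| = `|p.@[fun j => t * w j]|.
  by rewrite E normrM lam1 mul1r.
have [t0|t0] := eqVneq t 0.
  case/negP: top_neq; move: En; rewrite t0.
  have at0 f : f.@[fun j : 'I_n => 0 * w j] = f@_0.
    by rewrite -meval_at0; apply: meval_eq => j; rewrite mul0r.
  rewrite !at0 reflection_coef //; last by apply/mnm_lepP => i; rewrite mnm0E.
  by rewrite norm_conjC (_ : N - 0 = N)%MM ?subm0 // => ->.
apply/eqP; rewrite eq_le; apply/andP.
split; rewrite real_leNgt ?normr_real ?real1 //; apply/negP.
  move=> t1; pose s := (t^-1)^*.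
  have s0 : s != 0 by rewrite conjC_eq0 invr_eq0.
  have s1 : `|s| < 1 by rewrite norm_conjC normfV invf_lt1 // normr_gt0.
  have := reflection_lt w1 s0 s1; rewrite reflection_slice //.
  rewrite (_ : (s^-1)^* = t); last by rewrite /s fmorphV /= conjCK invrK.
  rewrite !normrM norm_conjC norm_monomial // mulr1 -En reflection_slice //.
  rewrite !normrM norm_conjC norm_monomial // mulr1 mulrA -normrM -exprMn.
  rewrite normrX normrM /s norm_conjC normfV mulVf ?normr_eq0 //.
  by rewrite expr1n mul1r ltxx.
by move=> t1; have := reflection_lt w1 t0 t1; rewrite En ltxx.
Qed.

(** The modulus at [t = 1] is that of the leading coefficient times the product of the distances
    from 1 to the roots. If all of these were at least [e], the value at [w] could not be so
    small. *)
Lemma level_zero_near (lam : C) w (e : C) : `|lam| = 1 -> (forall j, `|w j| = 1) ->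
  0 < e ->
  `|(reflection N p - lam *: p).@[w]| < `|(p@_0)^* - lam * p@_N| * e ^+ mdeg N ->
  exists t, [/\ `|t| = 1, `|t - 1| < e &
    (reflection N p - lam *: p).@[fun j => t * w j] = 0].
Proof.
move=> lam1 w1 e0; set q := reflection N p - lam *: p => small.
have qN : multidegree_le q N.
  by apply: multidegree_leB; [exact: reflection_multidegree_le | exact: multidegree_leZ].
have qtop : q@_N = (p@_0)^* - lam * p@_N.
  rewrite mcoeffB mcoeffZ reflection_coef //; last exact/mnm_lepP.
  rewrite (_ : N - N = 0)%MM //.
  by apply/mnmP => i; rewrite mnmBE mnm0E subnn.
(* The strict bound in [small] already forces a nonzero top coefficient, so the slice has exactly
   [mdeg N] roots. *)
have L0 : `|q@_N| != 0.
  apply: contraTneq small => L0; by rewrite -qtop L0 mul0r normr_lt0.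
have sq : size (slice w q) = (mdeg N).+1.
  apply/eqP; rewrite eqn_leq slice_size //= ltnNge; apply: contra L0 => /leq_sizeP.
  move/(_ _ (leqnn _)); rewrite slice_top_coef // => /eqP.
  by rewrite mulf_eq0 -[X in _ || X]normr_eq0 norm_monomial // oner_eq0 orbF normr_eq0.
have [rs ers] := closed_field_poly_normal (slice w q).
have lead : `|lead_coef (slice w q)| = `|q@_N|.
  by rewrite lead_coefE sq /= slice_top_coef // normrM norm_monomial // mulr1.
have srs : size rs = mdeg N.
  apply/eqP; rewrite -eqSS -sq ers size_scale ?size_prod_XsubC //.
  by rewrite -normr_eq0 lead.
have [/hasP[t trs te]|/hasPn far] := boolP (has (fun r => `|r - 1| < e) rs).
  have qt : q.@[fun j => t * w j] = 0.
    rewrite -slice_horner ers hornerZ horner_prod (big_rem _ trs) /=.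
    by rewrite hornerXsubC subrr mul0r mulr0.
  by exists t; split=> //; exact: level_zeros_on_circle qt.
suff : `|q@_N| * e ^+ mdeg N <= `|q.@[w]|.
  by rewrite qtop => H; have := le_lt_trans H small; rewrite ltxx.
have -> : q.@[w] = (slice w q).[1].
  by rewrite slice_horner; apply: meval_eq => j; rewrite mul1r.
rewrite ers hornerZ normrM lead ler_wpM2l // horner_prod normr_prod -srs.
elim: rs far {ers srs} => [|r rs IH] far; first by rewrite big_nil.
rewrite big_cons exprS ler_pM ?exprn_ge0 ?(ltW e0) //; last first.
  by apply: IH => s srs; apply: far; rewrite in_cons srs orbT.
rewrite !hornerE distrC real_leNgt ?normr_real ?gtr0_real //.
by apply: far; rewrite mem_head.
Qed.

End StablePolynomial.

(** * Level sets near the zeros of [p] *)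

Section Approximation.
Import Pdiv.Idomain.

(** The constant [c] comes from a Bezout relation with cleared denominators and plays the part of a
    resultant. *)
Lemma coprimep_common_root (A : idomainType) (P Q : {poly A}) : coprimep P Q ->
  exists2 c : A, c != 0 & forall (F : comNzRingType) (f : {rmorphism A -> F}) (t : F),
    (map_poly f P).[t] = 0 -> (map_poly f Q).[t] = 0 -> f c = 0.
Proof.
move=> /Bezout_coprimepP[[u v] /= /eqpP[[c1 c2] /= /andP[_ c20] E]].
exists c2 => // F f t Pt Qt.
have := congr1 (fun H => (map_poly f H).[t]) E.
rewrite -!mul_polyC mulr1 !rmorphM rmorphD !rmorphM /= !map_polyC.
by rewrite hornerM hornerD !hornerM !hornerC Pt Qt !mulr0 addr0 mulr0 => <-.
Qed.

Lemma level_set_approximates_zeros (C : numClosedFieldType) (n : nat) (N : 'X_{1..n})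
    (p : {mpoly C[n]}) (lam e : C) (z : 'I_n -> C) :
  (forall v, (forall j, `|v j| < 1) -> p.@[v] != 0) -> multidegree_le p N ->
  (forall f g h : {mpoly C[n]},
     p = f * g -> reflection N p = f * h -> exists c, f = c%:MP) ->
  `|lam| = 1 -> (forall j, `|z j| = 1) -> p.@[z] = 0 -> (reflection N p).@[z] = 0 ->
  0 < e ->
  exists w, [/\ forall j, `|w j| = 1, p.@[w] != 0,
    (reflection N p).@[w] = lam * p.@[w] & forall j, `|w j - z j| < e].
Proof.
move=> p_stable pN ncf lam1 z1 pz rz e0.
have p00 := const_coef_neq0 p_stable.
(* In the extremal case [p] divides its reflection, so it is constant by [ncf]; but it vanishes at
   [z] and not at 0. *)
have top_neq : `|p@_N| != `|p@_0|.
  apply/eqP => top; have pN0 : p@_N != 0 by rewrite -normr_eq0 top normr_eq0.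
  have [c ec] : exists c, p = c%:MP.
    apply: (ncf p 1 (((p@_0)^* / p@_N)%:MP)); first by rewrite mulr1.
    apply/eqP; rewrite -subr_eq0 -(mulrI_eq0 _ (mulfI (_ : (p@_N)%:MP != 0))) ?mpolyC_eq0 //.
    rewrite mulrBr subr_eq0 mul_mpolyC (extremal_reflection p_stable pN top).
    by rewrite mulrCA -mpolyCM [p@_N * _]mulrC divfK // mulrC mul_mpolyC.
  by move: p00 pz; rewrite ec mcoeffC eqxx mulr1 mevalC => /eqP.
have L0 : 0 < `|(p@_0)^* - lam * p@_N|.
  rewrite normr_gt0 subr_eq0; apply: contraNneq top_neq => E.
  by rewrite -(norm_conjC p@_0) E normrM lam1 mul1r.
set q := reflection N p - lam *: p.
have [K K0 HK] := meval_torus_lipschitz q.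
have qz : q.@[z] = 0 by rewrite mevalB mevalZ rz pz mulr0 subrr.
have e2 : 0 < e / 2 by rewrite divr_gt0.
(* Chosen so that [K * x] stays below the threshold of [level_zero_near] for radius [e / 2]; the
   [+ 1] keeps the denominator positive when [K = 0]. *)
pose x := `|(p@_0)^* - lam * p@_N| * (e / 2) ^+ mdeg N / (K + 1).
have K1 : 0 < K + 1 by rewrite ltr_wpDl.
have x0 : 0 < x by rewrite divr_gt0 // mulr_gt0 // exprn_gt0.
have [d [d0 dx de]] : exists d, [/\ 0 < d, d <= x & d <= e / 2].
  have [xe|ex] := real_leP (gtr0_real x0) (gtr0_real e2); first by exists x.
  by exists (e / 2); split=> //; exact: ltW.
apply: contrapT => nw.
(* The slice has a level zero within [e / 2] of 1. If [p] did not vanish there, it would give the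
   excluded point, the other half of [e] covering the distance from [w] to [z]. *)
have common_zero w : (forall j, `|w j| = 1) -> (forall j, `|w j - z j| < d) ->
    exists t, (slice w p).[t] = 0 /\ (slice w (reflection N p)).[t] = 0.
  move=> w1 wz.
  have [|t [t1 te qt]] := level_zero_near p_stable pN top_neq lam1 w1 e2.
    rewrite -/q -[q.@[w]]subr0 -qz.
    apply: le_lt_trans (HK w z d w1 z1 (fun j => ltW (wz j)) (ltW d0)) _.
    apply: le_lt_trans (ler_wpM2l K0 dx) _.
    by rewrite /x mulrCA gtr_pMr ?mulr_gt0 ?exprn_gt0 // ltr_pdivrMr // mul1r ltrDl.
  have lev : (reflection N p).@[fun j => t * w j] = lam * p.@[fun j => t * w j].
    by apply/eqP; rewrite -subr_eq0 -mevalZ -mevalB; apply/eqP.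
  have [pt|pt] := eqVneq p.@[fun j => t * w j] 0.
    exists t; split; rewrite slice_horner; first exact: pt.
    by rewrite lev pt mulr0.
  case: nw; exists (fun j => t * w j); split=> // j; first by rewrite normrM t1 w1 mulr1.
  have -> : t * w j - z j = (t - 1) * w j + (w j - z j) by ring.
  rewrite (le_lt_trans (ler_normD _ _)) // normrM w1 mulr1 [e]splitr ltrD //.
  exact: lt_le_trans (wz j) de.
have dC : zariski_dense (fun y : C => y != 0).
  move=> h h0; apply: (zariski_dense_arc (normr1 C) (@ltr01 C)) => t [t1 _].
  by apply: h0; rewrite -normr_eq0 t1 oner_eq0.
have cop : coprimep (cone p) (cone (reflection N p)).
  by apply: cone_coprime => //; rewrite meval_at0.
have [c c0 cP] := coprimep_common_root cop.
(* The resultant [c] vanishes on a product of arcs around the coordinates of [z], hence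
   identically. *)
case/eqP: c0; apply: (@mpoly_eq0_on_product C n (fun j y => `|y| = 1 /\ `|y - z j| < d)).
  by move=> j; exact: zariski_dense_arc.
move=> w wS; have [t [pt rt]] := common_zero w (fun j => (wS j).1) (fun j => (wS j).2).
have cw := cP _ (meval w) t.
by apply: cw; [exact: pt | exact: rt].
Qed.

End Approximation.

(** * Real radii and the equality of the two sets *)

Lemma complex_gt0 (R : rcfType) (c : R[i]) : 0 < c -> exists2 e : R, 0 < e & c = (e%:C)%C.
Proof.
(* The order on [R[i]] compares only numbers with equal imaginary parts. *)
by case: c => a b; rewrite ltcE /= => /andP[/eqP -> a0]; exists a.
Qed.

Theorem theorem2p6 (R : realType) (d : nat) (p : {mpoly R[i][d]}) (n : 'X_{1..d}) :
  RIF_repr p n ->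
  forall lam : R[i], `|lam| = 1 ->
  forall z : 'I_d -> R[i], Clam p n lam z <-> Llam p n lam z.
Proof.
move=> [p_stable pn ncf] lam lam1 z.
have pN : multidegree_le p n by move=> m mp; apply/mnm_lepP; exact: pn.
have rE : reflect_poly n p = reflection n p by [].
split; last first.
  move=> [z1 lev]; have [pz|pz] := eqVneq p.@[z] 0; last first.
    (* Off the zeros of [p], the point [z] itself lies on the level set. *)
    move=> e e0; exists z; first by split=> //; rewrite lev mulfK.
    by move=> j; rewrite subrr normr0 ltcR.
  move=> e e0; have eC : 0 < (e%:C)%C by rewrite ltcR.
  have [|w [w1 pw wl wz]] := level_set_approximates_zeros p_stable pN ncf lam1 z1 pz _ eC.
    by rewrite -rE lev pz mulr0.
  by exists w => //; split=> //; rewrite rE wl mulfK.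
move=> zC.
(* The torus is closed: [z j] is at distance at least [| |z j| - 1 |] from any point of the
   circle. *)
have z1 j : `|z j| = 1.
  apply/eqP/negPn/negP => zj.
  have : 0 < `| `|z j| - 1| by rewrite normr_gt0 subr_eq0.
  move=> /complex_gt0[e e0 ee]; have [w [w1 _ _] /(_ j)] := zC e e0.
  rewrite -ee -(w1 j) distrC => H.
  by have := lt_le_trans H (ler_dist_dist (z j) (w j)); rewrite distrC ltxx.
split=> //; apply/eqP; rewrite -subr_eq0 -mevalZ -mevalB; set q := _ - _.
have [K K0 HK] := meval_torus_lipschitz q.
apply/negPn/negP => qz.
(* Within this radius of [z], the Lipschitz bound keeps [q] from reaching 0 on the torus, whereas
   [q] vanishes on the level set. *)
have x0 : 0 < `|q.@[z]| / (K + 1) by rewrite divr_gt0 ?normr_gt0 // ltr_wpDl.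
have [e e0 ee] := complex_gt0 x0.
have [w [w1 pw wl] wz] := zC e e0.
have qw : q.@[w] = 0 by rewrite mevalB mevalZ -wl divfK // subrr.
have := HK z w (e%:C)%C z1 w1.
rewrite qw subr0 -ee => H.
have : `|q.@[z]| <= K * (`|q.@[z]| / (K + 1)).
  by apply: H => [j|]; rewrite ltW // distrC ee.
rewrite mulrCA ler_pMr ?normr_gt0 // ler_pdivlMr ?ltr_wpDl // mul1r.
by rewrite gerDl ler10.
Qed.
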